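(* There exists a shape $S$ such that for any choice of origin (i.e. for every translate of $S$ that contains the origin node) and for every amoebot algorithm $\mathcal{A}$ that terminates after $o(\sqrt{n})$ rounds, where $n$ is the number of amoebots, there exists an amoebot structure $A$ for which the algorithm does not compute $\mathcal{V}(k_{\max}(S, A) \cdot S, A)$, even if $k_{\max}(S,A)$ is known to the amoebots.
   Context: Grid and shapes. Let $G_\Delta=(V_\Delta,E_\Delta)$ be the infinite regular triangular grid graph, embedded in $\mathbb{R}^2$ so that its faces are equilateral triangles of side length 1, one node is at the origin and one grid axis is the $x$-axis. A shape $S\subset\mathbb{R}^2$ is a finite union of grid nodes, (closed) edges and (closed) triangular faces that is connected; shapes are assumed to contain the origin. $V(S)\subset V_\Delta$ is the set of grid nodes in $S$; $S^{(r)}$ is $S$ rotated counter-clockwise by $r\cdot 60^\circ$ around the origin; $S+t$ is the translate by $t$; $k\cdot S=\{k p: p\in S\}$. Placements. An amoebot structure $A\subset V_\Delta$ is a finite set of nodes inducing a connected subgraph; $n=|A|$. $\mathcal{V}(S,A)=\{p\in A : V(S+p)\subseteq A\}$ is the set of valid placements. $k_{\max}(S,A)=\sup\{k\in\mathbb{N}_0 : \exists r\in\mathbb{Z},\ \mathcal{V}(k\cdot S^{(r)},A)\neq\emptyset\}$. Computational model (geometric amoebot model with reconfigurable circuits). Each node of $A$ is occupied by one amoebot: identical, possibly randomized, finite state machines with constant memory (independent of $n$), all starting in the same state, sharing a common compass and chirality, acting in fully synchronous rounds. On each edge between neighboring amoebots there is a constant number $c$ (fixed by the algorithm) of external links, each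 amoebot owning one end point (pin) of each incident link, with common labeling. Each amoebot partitions its pins into partition sets; two partition sets of neighbors are connected if they share a link; connected components of partition sets are circuits. In each round, every amoebot may change its state (based on its current state and received signals), rearrange its partition sets, and send a beep on any of its partition sets; a beep is received in the next round by all partition sets of the circuit, without information about origin or number of beeps. All communication between amoebots takes place via circuits. An algorithm computes a set $C\subseteq A$ if, upon termination, each amoebot knows (correctly, regardless of random choices) whether it belongs to $C$. *)

(* Defs.v *)
From HB Require Import structures.
From mathcomp Require Import all_boot all_order all_algebra finmap.
From mathcomp Require Import all_classical all_reals all_analysis.
Import Order.TTheory GRing.Theory Num.Theory.
Import numFieldNormedType.Exports.

Set Implicit Arguments.
Unset Strict Implicit.
Unset Printing Implicit Defensive.

Local Open Scope fset_scope.
Local Open Scope classical_set_scope.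
Local Open Scope ring_scope.

(** * The triangular grid *)

(* Axial coordinates: (a, b) is the grid node a * (1, 0) + b * (1/2, sqrt 3 / 2)
   of the plane. *)
Definition grid := (int * int)%type.

(* The six unit vectors, counter-clockwise from the positive x-axis; addition of
   directions is addition modulo 6, so that d + 3 is the opposite of d. *)
Definition direction := 'I_6.

Definition dir (d : direction) : grid :=
  nth (0, 0)
    [:: (1, 0); (0, 1); (-1, 1); (-1, 0); (0, -1); (1, -1)] d.

Definition plane (R : realType) := (R^o * R^o)%type.

Section Shapes.
Variable R : realType.
Implicit Types (S : set (plane R)) (A : {fset grid}).

Definition embed (u : grid) : plane R :=
  (u.1%:~R + u.2%:~R / 2, Num.sqrt 3 / 2 * u.2%:~R).

Inductive cell :=
  | Node of grid
  | Edge of grid & direction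
  | Face of grid & direction.

Definition corners (x : cell) : seq grid :=
  match x with
  | Node u => [:: u]
  | Edge u d => [:: u; u + dir d]
  | Face u d => [:: u; u + dir d; u + dir (d + 1)]
  end.

(* Closed convex hull of the corners. *)
Definition realization (x : cell) : set (plane R) :=
  [set p | exists w : nat -> R,
     [/\ forall i, 0 <= w i,
         \sum_(0 <= i < size (corners x)) w i = 1 &
         p = \sum_(0 <= i < size (corners x))
               w i *: embed (nth 0 (corners x) i)]].

Definition is_shape S :=
  [/\ exists s : seq cell,
        S = \big[setU/set0]_(x <- s) realization x,
      connected S &
      S 0].

Definition nodes S : set grid := [set u | S (embed u)].

Definition translate (t : plane R) S : set (plane R) := [set p + t | p in S].

Definition scale (k : nat) S : set (plane R) := [set k%:R *: p | p in S].

Definition rotate (r : int) S : set (plane R) :=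
  let a := r%:~R * (pi / 3) in
  [set (cos a * p.1 - sin a * p.2, sin a * p.1 + cos a * p.2) | p in S].

Definition placements S A : set grid :=
  [set p | p \in A /\
    forall u, nodes (translate (embed p) S) u -> u \in A].

(* The supremum is taken in the extended reals: it is +oo when S is a single
   node. *)
Definition kmax S A : \bar R :=
  ereal_sup [set k%:R%:E | k in
    [set k : nat | exists r : int, placements (scale k (rotate r S)) A !=set0]].

End Shapes.

(** * Amoebot structures and algorithms *)

Definition induced (A : {fset grid}) : rel A :=
  fun u v => [exists d : direction, val v == val u + dir d].

Definition amoebot_structure (A : {fset grid}) :=
  A != fset0 /\ forall u v : A, connect (@induced A) u v.

(* Pin (d, i) of an amoebot is its end point of link i on its incident edge in
   direction d; pins on edges that lead to an unoccupied node are inert. *)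
Definition pin (c : nat) := (direction * 'I_c)%type.

(* A partition of the pins is a labelling: two pins are in the same partition
   set when they have the same label.  There are as many labels as pins, so every
   partition is obtained. *)
Definition pin_partition (c : nat) := {ffun pin c -> pin c}.

Record action (c : nat) (Q : Type) := Action {
  next_state : Q;
  next_partition : pin_partition c;
  beeps : {set pin c} (* labels of the partition sets that beep *)
}.

(* One machine, run by all amoebots.  The first argument of [init] and [step] is
   the scale that is known to the amoebots: it can be read at any time, but the
   number of states does not depend on it.  The other arguments of [step] are the
   directions of the occupied neighboring nodes, the current state, the labels of
   the partition sets on which a beep is received and the outcome of the random
   choice.  All outcomes in [coin] have positive probability; as correctness and
   runtime are required for all random choices, the probabilities themselves
   are irrelevant.  [output q = Some b] says that q is final, with answer b to
   the question whether the amoebot belongs to the computed set. *)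
Record algorithm := Algorithm {
  links : nat;
  state : finType;
  coin : finType;
  coin_gt0 : (0 < #|coin|)%N;
  init : nat -> state;
  step : nat -> {set direction} -> state -> {set pin links} -> coin ->
         action links state;
  output : state -> option bool
}.

Section Execution.
Variables (alg : algorithm) (k : nat) (A : {fset grid}).

Let c := links alg.

Record local_config := LocalConfig {
  lstate : state alg;
  lpartition : pin_partition c;
  received : {set pin c}
}.

Definition occupied (u : A) : {set direction} :=
  [set d : direction | val u + dir d \in A]%SET.

(* A final amoebot no longer acts: it keeps its state and its partition and does
   not beep. *)
Definition act (x : local_config) (u : A) (z : coin alg) : action c (state alg) :=
  if output (lstate x) is Some _ then
    Action (lstate x) (lpartition x) finset.set0
  else step k (occupied u) (lstate x) (received x) z.

(* Partition sets are identified by an amoebot and a label. *)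
Definition share_link (P : A -> pin_partition c) : rel (A * pin c) :=
  fun x y => [exists d : direction, [exists i : 'I_c,
    [&& val y.1 == val x.1 + dir d,
        P x.1 (d, i) == x.2 &
        P y.1 (d + 3%:R, i) == y.2]]].

(* Circuits are the classes of [connect (share_link P)]. *)
Definition deliver (P : A -> pin_partition c) (B : A -> {set pin c}) (u : A) :
    {set pin c} :=
  [set l : pin c | [exists x : A * pin c,
     (x.2 \in B x.1) && connect (share_link P) x (u, l)]]%SET.

Fixpoint run (omega : nat -> A -> coin alg) (t : nat) : A -> local_config :=
  if t is t'.+1 then
    let a u := act (run omega t' u) u (omega t' u) in
    let P u := next_partition (a u) in
    let B u := beeps (a u) in
    fun u => LocalConfig (next_state (a u)) (P u) (deliver P B u)
  else fun=> LocalConfig (init alg k) [ffun p => p] finset.set0.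

Definition answer omega t (u : A) : option bool :=
  output (lstate (run omega t u)).

Definition terminated omega t := forall u : A, answer omega t u <> None.

Definition terminates_within (t : nat) := forall omega, terminated omega t.

Definition computes (C : set grid) :=
  forall omega, exists t, terminated omega t /\
    forall u : A, answer omega t u = Some true <-> C (val u).

End Execution.

(* Main.v *)
(* Let S be the path of unit edges through (0,1), (0,0), (1,0), (1,1) in axial
   coordinates.  Two towers of width m and height 2m are joined by the base row
   only, and some of their top nodes are missing.  At scale 2m, the placement of S
   over column x is valid if and only if the tops of column x of both towers are
   present, whereas every rotation of a larger copy of S is too high.  So the
   amoebots of one tower must learn an arbitrary subset of the columns of the
   other one through a single edge.  The evolution of a tower is determined by
   the signals received at its end of that edge, and T rounds allow only 2^O(T)
   sequences of such signals, hence T is at least of the order of m, that is, of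
   the square root of the number of amoebots. *)
Require Import Defs.
From mathcomp Require Import all_boot all_order all_algebra finmap zify ring lra.
From mathcomp Require Import all_classical all_reals all_analysis.
Import Order.TTheory GRing.Theory Num.Theory.
Import numFieldNormedType.Exports.
Set Implicit Arguments.
Unset Strict Implicit.
Unset Printing Implicit Defensive.
Local Open Scope fset_scope.
Local Open Scope classical_set_scope.
Local Open Scope ring_scope.

(** * Communication through a bottleneck *)

Lemma deliver_step (alg : algorithm) (A : {fset grid})
    (P : A -> pin_partition (links alg)) (B : A -> {set pin (links alg)}) x y :
  share_link P x y -> x.2 \in deliver P B x.1 -> y.2 \in deliver P B y.1.
Proof.
move=> xy; rewrite !inE => /existsP[z /andP[zB zx]]; apply/existsP; exists z.
rewrite zB /=; apply: connect_trans (zx) _; apply: connect1.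
by case: x y xy {zx} => [? ?] [? ?].
Qed.

Section Bottleneck.
Variables (alg : algorithm) (k : nat) (z : coin alg).
Variables (L : pred grid) (a : grid).

Notation run0 A := (@run alg k A (fun=> fun=> z)).

(** [L] is one side of a cut. Every edge that enters it from outside ends at [a], so outside signals
    reach [L] only through the pins of [a]. *)
Definition bottleneck (A : {fset grid}) :=
  forall u v d, u \in A -> v \in A -> ~~ L u -> L v -> v = u + dir d -> v = a.

(** The second clause also covers neighbors outside [L], because an amoebot sees which adjacent
    nodes are occupied. *)
Definition agree (A A' : {fset grid}) :=
  (forall u, L u -> (u \in A) = (u \in A')) /\
  (forall u d, L u -> u \in A -> (u + dir d \in A) = (u + dir d \in A')).

Lemma agree_sym A A' : agree A A' -> agree A' A.
Proof.
by case=> AA' occ; split=> [u Lu|u d Lu]; rewrite -AA'// => uA; rewrite occ.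
Qed.

(* A circuit path that enters L does so at a, where both structures receive the same
   beeps; its continuation inside L exists in both of them. *)
Lemma deliver_sub (A A' : {fset grid}) (c := links alg)
    (P : A -> pin_partition c) (P' : A' -> pin_partition c)
    (B : A -> {set pin c}) (B' : A' -> {set pin c}) :
  bottleneck A -> agree A A' ->
  (forall u u', L (val u) -> val u = val u' -> P u = P' u' /\ B u = B' u') ->
  (forall u u', val u = a -> val u' = a -> deliver P B u = deliver P' B' u') ->
  forall u u', L (val u) -> val u = val u' ->
    {subset deliver P B u <= deliver P' B' u'}.
Proof.
move=> cutA [AA' _] PB Da u u' Lu uu' l.
rewrite inE => /existsP[x /andP[xB /connectP[p px lastp]]].
(* The path may leave [L] and return, so the invariant records delivery in [A] everywhere and
   delivery in [A'] only at nodes of [L]. *)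
suff: forall p, path (share_link P) x p ->
    let y := last x p in
    y.2 \in deliver P B y.1 /\
    (L (val y.1) -> forall v', val v' = val y.1 -> y.2 \in deliver P' B' v').
  by move=> /(_ p px) /=; rewrite -lastp /= => -[_]; apply.
elim/last_ind => [_|q y IHq] /=.
  split=> [|Lx v' v'x].
    by rewrite inE; apply/existsP; exists x; rewrite xB; case: (x) => * /=.
  rewrite inE; apply/existsP; exists (v', x.2); rewrite connect0 andbT.
  by have [_ <-] := PB _ _ Lx (esym v'x).
rewrite rcons_path last_rcons => /andP[/IHq]; set w := last x q => -[wD wL] wy.
have yD := deliver_step wy wD.
split=> // Ly v' v'y.
have /existsP[d /existsP[i /and3P[/eqP ywd /eqP Pw /eqP Py]]] := wy.
have [Lw|nLw] := boolP (L (val w.1)); last first.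
  have ya := cutA _ _ _ (valP w.1) (valP y.1) nLw Ly ywd.
  by rewrite -(Da y.1 v' ya (etrans v'y ya)).
have wA' : val w.1 \in A' by rewrite -AA' // (valP w.1).
have wD' := wL Lw [` wA'] erefl.
apply: (@deliver_step alg _ _ _ ([` wA'], w.2) (v', y.2)) wD'.
apply/existsP; exists d; apply/existsP; exists i => /=.
have [<- _] := PB w.1 [` wA'] Lw erefl.
have [<- _] := PB y.1 v' Ly (esym v'y).
by rewrite v'y ywd eqxx Pw Py !eqxx.
Qed.

(** With a constant coin, an action in [L] depends on the configuration and the occupied directions.
    By induction on time these agree, and [deliver_sub], applied in both directions, gives equal
    beeps in the next round. *)
Lemma bottleneck_run (A A' : {fset grid}) (t : nat) :
  bottleneck A -> bottleneck A' -> agree A A' ->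
  (forall s, (s < t)%N -> forall u u', val u = a -> val u' = a ->
    received (run0 A s.+1 u) = received (run0 A' s.+1 u')) ->
  forall u u', L (val u) -> val u = val u' -> run0 A t u = run0 A' t u'.
Proof.
move=> cutA cutA' AA'; elim: t => [//|t IH] rec u u' Lu uu'.
have {}IH v v' : L (val v) -> val v = val v' -> run0 A t v = run0 A' t v'.
  by apply: IH => s st; apply: rec; apply: ltnW.
have actE v v' : L (val v) -> val v = val v' ->
    act k (run0 A t v) v z = act k (run0 A' t v') v' z.
  move=> Lv vv'; rewrite /act (IH v v')//; case: output => //.
  congr step; apply/setP => d; rewrite !inE -vv'; apply: AA'.2 => //.
  exact: valP.
rewrite /= (actE u u')//; congr LocalConfig.
have recA := rec t (ltnSn _); rewrite /= in recA.
apply/eqP; rewrite finset.eqEsubset; apply/andP; split; apply/fintype.subsetP.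
  apply: deliver_sub => // v v' Lv vv'; by rewrite (actE v v').
apply: deliver_sub => //.
- exact: agree_sym.
- by move=> v v' Lv vv'; rewrite (actE v' v)// -vv'.
- by move=> v v' va v'a; rewrite (recA v' v).
- by rewrite -uu'.
Qed.

End Bottleneck.

(** * Stability of answers *)

Section Termination.
Variables (alg : algorithm) (k : nat) (A : {fset grid}).
Variable omega : nat -> A -> coin alg.

Lemma answer_stable t t' u b : (t <= t')%N ->
  @answer alg k A omega t u = Some b -> @answer alg k A omega t' u = Some b.
Proof.
move=> /subnK <-; elim: (t' - t)%N => [//|s IH] /IH.
by rewrite /answer addSn /= /act; case E: output => //=; rewrite E.
Qed.

(** The time provided by [computes] is unrelated to [t]. Since answers persist, both are compared at
    the maximum of the two times. *)
Lemma computes_at C T t : terminates_within alg k A T -> (T <= t)%N ->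
  computes alg k A C -> forall u, answer k omega t u = Some true <-> C (val u).
Proof.
move=> hT Tt /(_ omega)[s [st sC]] u; rewrite -sC.
have hTu := hT omega u; case E : (answer k omega T u) hTu => [b|//] _.
have {}E := answer_stable Tt E; rewrite E.
have := st u; case F : (answer k omega s u) => [b'|//] _.
have := answer_stable (leq_maxl s t) F; have := answer_stable (leq_maxr s t) E.
by move=> -> [->].
Qed.

End Termination.

(** What [a] receives in [T] rounds determines all answers in [L], hence [Y]. Each round delivers a
    subset of the [6 * links alg] labels, so at most [2 ^ (6 * links alg * T)] transcripts must
    separate [2 ^ n] sets. *)
Lemma bottleneck_count (alg : algorithm) (k n T : nat)
    (L : pred grid) (a : grid)
    (A : {set 'I_n} -> {fset grid}) (C : {set 'I_n} -> set grid)
    (p : 'I_n -> grid) :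
  (forall Y, a \in A Y) ->
  (forall Y, bottleneck L a (A Y)) ->
  (forall Y Y', agree L (A Y) (A Y')) ->
  (forall Y, exists2 t, (t <= T)%N & terminates_within alg k (A Y) t) ->
  (forall Y, computes alg k (A Y) (C Y)) ->
  (forall i, L (p i)) -> (forall Y i, p i \in A Y) ->
  (forall Y i, C Y (p i) <-> i \notin Y) ->
  (n <= 6 * links alg * T)%N.
Proof.
move=> aA cutA agA term comp Lp pA CE.
(* Correctness is required for all random choices, so repeating a single outcome [z] makes the
   algorithm deterministic. *)
have [z _] : exists z : coin alg, z \in coin alg by apply/card_gt0P/coin_gt0.
pose tr Y : {ffun 'I_T -> {set pin (links alg)}} :=
  [ffun s : 'I_T => received (@run alg k (A Y) (fun=> fun=> z) s.+1 [` aA Y])].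
have tr_inj : injective tr.
  move=> Y Y' YY'.
  have runE : forall u u', L (val u) -> val u = val u' ->
      @run alg k (A Y) (fun=> fun=> z) T u =
      @run alg k (A Y') (fun=> fun=> z) T u'.
    apply: (bottleneck_run (a := a)) => // s sT u u' ua u'a.
    have /ffunP/(_ (Ordinal sT)) := YY'; rewrite !ffunE /=.
    have -> : u = [` aA Y] by apply: val_inj.
    by have -> : u' = [` aA Y'] by apply: val_inj.
  apply/setP => i.
  have ansE (X : {set 'I_n}) : i \notin X <->
      answer k (fun=> fun=> z) T [` pA X i] = Some true.
    have [t tT ht] := term X.
    by rewrite (computes_at _ ht tT (comp X)) /= CE.
  have eqa : answer k (fun=> fun=> z) T [` pA Y i] =
             answer k (fun=> fun=> z) T [` pA Y' i].
    by rewrite /answer (runE [` pA Y i] [` pA Y' i] (Lp i)).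
  by apply: negb_inj; apply/idP/idP => /ansE h; apply/ansE; rewrite -h eqa.
have setE (U : finType) : #|{set U}| = (2 ^ #|U|)%N.
  by rewrite -(cardsT U) -card_powerset finset.powersetT cardsT.
have := leq_card tr tr_inj.
rewrite card_ffun !setE card_prod !card_ord -expnM leq_exp2l //.
Qed.

(** * Two towers joined by a row *)

Lemma dirP (d : direction) :
  dir d \in [:: (1, 0); (0, 1); (-1, 1); (-1, 0); (0, -1); (1, -1)].
Proof. by case: d => [[|[|[|[|[|[|//]]]]]] ?]. Qed.

Lemma induced_sym (A : {fset grid}) : symmetric (@Defs.induced A).
Proof.
suff H u v : Defs.induced u v -> @Defs.induced A v u.
  by move=> u v; apply/idP/idP; exact: H.
move=> /existsP[d /eqP vu]; apply/existsP; exists (d + 3%:R).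
suff -> : dir (d + 3%:R) = - dir d by rewrite vu addrK.
by case: d {vu} => [[|[|[|[|[|[|//]]]]]] ?]; apply/eqP.
Qed.

(** [D] marks the columns whose top node, in row [2 * m], is removed. Between the towers only row 0
    is left. *)
Definition in_towers (m : nat) (D : pred int) (u : grid) :=
  [&& 0 <= u.1, u.1 < 3 * m%:Z, 0 <= u.2, u.2 <= 2 * m%:Z &
   (u.2 == 0) || (((u.1 < m%:Z) || (2 * m%:Z <= u.1)) &&
                  ((u.2 < 2 * m%:Z) || ~~ D u.1))].

Definition towers (m : nat) (D : pred int) : {fset grid} :=
  [fset u in [seq (Posz x, Posz y) |
                x <- iota 0 (3 * m), y <- iota 0 (2 * m).+1] | in_towers m D u].

Lemma towersE m D u : (u \in towers m D) = in_towers m D u.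
Proof.
rewrite !inE; apply: andb_idl => /and5P[x0 x3 y0 y2 _].
apply/allpairsP; exists (`|u.1|%N, `|u.2|%N); rewrite !mem_iota /=.
by split; [lia|lia|case: u x0 y0 {x3 y2} => -[x|x] [y|y]].
Qed.

(** From any node, walk down its column (direction 4), then left along row 0 (direction 3). Missing
    tops never block this walk, and each step lowers the coordinate sum by one. *)
Lemma towers_structure m D : (0 < m)%N -> amoebot_structure (towers m D).
Proof.
move=> m0; have oA : (0, 0) \in towers m D.
  by rewrite towersE /in_towers /=; lia.
suff H n (u : towers m D) :
    (val u).1 + (val u).2 = n%:Z -> connect (@Defs.induced _) u [` oA].
  split=> [|u v]; first by apply/fset0Pn; exists (0, 0).
  have ex (w : towers m D) : exists n, (val w).1 + (val w).2 = Posz n.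
    have := valP w; rewrite towersE.
    case: (val w) => x y /and5P[/= x0 _ y0 _ _].
    by exists (absz (x + y)); lia.
  have [[n1 ?] [n2 ?]] := (ex u, ex v).
  by apply: connect_trans (H n1 _ _) _ => //;
    rewrite (sym_connect_sym (@induced_sym _)) (H n2).
elim: n u => [|n IH] u un.
  suff -> : u = [` oA] by exact: connect0.
  apply: val_inj; have := valP u; rewrite towersE; move: un.
  case: (val u) => x y /=.
  by rewrite /in_towers /= => un h; congr pair; lia.
have [d dA dn] : exists2 d, val u + dir d \in towers m D &
    (val u + dir d).1 + (val u + dir d).2 = n%:Z.
  have [u20|u20] := eqVneq (val u).2 0.
    exists (inord 3); move: un u20 (valP u); rewrite !towersE /dir inordK //=;
    by case: (val u) => x y /=; rewrite /in_towers /=; lia.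
  exists (inord 4); move: un u20 (valP u); rewrite !towersE /dir inordK //=;
  by case: (val u) => x y /=; rewrite /in_towers /=; lia.
apply: connect_trans (IH [` dA] dn); apply: connect1.
by apply/existsP; exists d.
Qed.

Lemma card_towers_ub m D : (0 < m)%N -> (#|` towers m D| <= (3 * m) ^ 2)%N.
Proof.
move=> m0; apply: leq_trans (_ : 3 * m * (2 * m).+1 <= _)%N; last by nia.
set s := [seq (Posz x, Posz y) | x <- iota 0 (3 * m), y <- iota 0 (2 * m).+1].
have /fsubset_leq_card/leq_trans -> // : (towers m D `<=` [fset u in s])%fset.
  by apply/fsubsetP => u; rewrite !inE => /andP[].
by rewrite card_fseq (leq_trans (size_undup _)) // size_allpairs !size_iota.
Qed.

(** A crude bound from the base of the left tower suffices: it only has to push the size past the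
    threshold of the little-o hypothesis. *)
Lemma card_towers_lb m D : (m <= #|` towers m D|)%N.
Proof.
set s := [seq (Posz i, 0) : grid | i <- iota 0 m].
have us : uniq s by rewrite map_inj_uniq ?iota_uniq // => i j [].
have sm : #|` [fset u in s]| = m.
  by rewrite card_fseq undup_id // size_map size_iota.
rewrite -{1}sm; apply: fsubset_leq_card; apply/fsubsetP => u.
rewrite towersE !inE => /mapP[i]; rewrite mem_iota => im ->.
by rewrite /in_towers /=; lia.
Qed.

(* The half of the towers that contains the origins of the placements, and its
   only node with a neighbor in the other half. *)
Definition half (m : nat) (o : bool) : pred grid :=
  fun u => if o then 2 * m%:Z <= u.1 else u.1 < 2 * m%:Z.

Definition gate (m : nat) (o : bool) : grid :=
  (2 * m%:Z - (~~ o)%:Z, 0).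

(** Edges between the halves join columns [2 * m - 1] and [2 * m], and the former has only its base
    node. *)
Lemma towers_bottleneck m o D : (0 < m)%N ->
  bottleneck (half m o) (gate m o) (towers m D).
Proof.
move=> m0 u v d; rewrite !towersE => + + + + ve; have := dirP d.
case: u v (dir d) ve => [x y] [x' y'] [dx dy] [-> ->].
rewrite /in_towers /half /gate !inE !xpair_eqE /=.
by case: o => /= ? ? ? ? ?; congr pair; lia.
Qed.

(** Across the cut, the occupancy of a neighbor never depends on [D]: column [2 * m - 1] has only
    its base node, whose only occupied neighbor in column [2 * m] is in row 0. *)
Lemma towers_agree m o D D' : (0 < m)%N ->
  (forall u, half m o u -> D u.1 = D' u.1) ->
  agree (half m o) (towers m D) (towers m D').
Proof.
move=> m0 DD'.
have H u : half m o u -> (u \in towers m D) = (u \in towers m D').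
  by move=> Lu; rewrite !towersE /in_towers (DD' u).
split=> // u d Lu uA.
have [|nL] := boolP (half m o (u + dir d)); first exact: H.
move: uA Lu nL; rewrite !towersE; have := dirP d.
case: u (dir d) => [x y] [dx dy].
rewrite /in_towers /half !inE !xpair_eqE /=.
by case: o DD' H => /= _ _; lia.
Qed.

(** * The shape in the plane *)

Section UShape.
Variable R : realType.

(** [embed] with real coefficients. In these coordinates a turn by 60 degrees has an integer matrix,
    free of the root of 3. *)
Definition axial (a b : R) : plane R := (a + b / 2, Num.sqrt 3 / 2 * b).

Lemma embedE u : embed R u = axial u.1%:~R u.2%:~R.
Proof. by []. Qed.

Lemma axial_inj a b a' b' : axial a b = axial a' b' -> a = a' /\ b = b'.
Proof.
move=> [ea eb]; have s3 : Num.sqrt 3 / 2 != 0 :> R.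
  by rewrite mulf_neq0 // ?invr_eq0 // sqrtr_eq0 -ltNge.
have {}eb := mulfI s3 eb; split=> //; move: ea; rewrite eb; exact: addIr.
Qed.

Lemma axialD a b a' b' : axial a b + axial a' b' = axial (a + a') (b + b').
Proof. by congr pair; rewrite /=; ring. Qed.

Lemma axialZ c a b : c *: axial a b = axial (c * a) (c * b).
Proof.
by rewrite /axial; congr pair => /=; rewrite /GRing.scale /=; ring.
Qed.

(** * Rotations by multiples of 60 degrees *)

Lemma cos_pi3 : cos (pi / 3) = 1 / 2 :> R.
Proof.
have p0 := pi_gt0 R; set x := pi / 3.
have c0 : 0 < cos x by apply: cos_gt0_pihalf; rewrite /x; lra.
have : cos (x *+ 2 + x) = - 1.
  by rewrite -cospi; congr cos; rewrite /x; field.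
rewrite cosD cos_mulr2n sin_mulr2n.
have -> : (cos x * sin x) *+ 2 * sin x = 2 * cos x * (1 - cos x ^+ 2).
  by rewrite -sin2cos2; ring.
set c := cos x in c0 *; move=> e.
(* The triple-angle formula at [pi] reads [4 c^3 - 3 c = -1], which factors this way; [c] is the
   positive root. *)
have : (c + 1) * (2 * c - 1) ^+ 2 = 0.
  by rewrite -[RHS](subrr (-1 : R)) -[X in _ = X - _]e; ring.
by move=> /eqP; rewrite mulf_eq0 expf_eq0 /= => /orP[] /eqP; lra.
Qed.

Lemma sin_pi3 : sin (pi / 3) = Num.sqrt 3 / 2 :> R.
Proof.
have p0 := pi_gt0 R.
have s0 : 0 <= sin (pi / 3 : R) by apply: sin_ge0_pi; lra.
rewrite -[LHS]ger0_norm // -sqrtr_sqr sin2cos2 cos_pi3.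
have -> : 1 - (1 / 2) ^+ 2 = 3 * (2^-1) ^+ 2 :> R by field.
by rewrite sqrtrM // sqrtr_sqr ger0_norm ?invr_ge0.
Qed.

Lemma rotate0 S : rotate 0 S = S :> set (plane R).
Proof.
rewrite /rotate mul0r cos0 sin0 -[RHS]image_id; congr (_ @` S).
apply/funext=> -[x y] /=.
by rewrite !mul1r !mul0r subr0 add0r.
Qed.

Lemma rotateD r r' S :
  rotate (r + r') S = rotate r (rotate r' S) :> set (plane R).
Proof.
rewrite /rotate image_comp; congr (_ @` S); apply/funext=> p /=.
by rewrite intrD mulrDl cosD sinD; congr pair; ring.
Qed.

Lemma rotate1 S a b : S (axial a b) -> rotate 1 S (axial (- b) (a + b)).
Proof.
move=> Sab; exists (axial a b) => //=; rewrite mul1r cos_pi3 sin_pi3.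
rewrite /axial; have := sqr_sqrtr (ler0n R 3).
set s := Num.sqrt 3 => ss; congr pair; last by field.
rewrite (_ : _ - _ = 1 / 2 * (a + b / 2) - s ^+ 2 / 4 * b); last by field.
by rewrite ss; field.
Qed.

Lemma rotateN1 S a b : S (axial a b) -> rotate (- 1) S (axial (a + b) (- a)).
Proof.
move=> Sab; exists (axial a b) => //=; rewrite mulN1r cosN sinN cos_pi3 sin_pi3.
rewrite /axial; have := sqr_sqrtr (ler0n R 3).
set s := Num.sqrt 3 => ss; congr pair; last by field.
rewrite (_ : _ - _ = 1 / 2 * (a + b / 2) + s ^+ 2 / 4 * b); last by field.
by rewrite ss; field.
Qed.

(** [(al, be)] is the row of the rotation matrix that gives the height. One more turn, applied
    first, keeps it integral and non-zero, as the height bound requires. *)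
Lemma rotate_axial (r : int) : exists al be ga de : int,
  (al, be) != (0, 0) /\ forall (a b : R) S, S (axial a b) ->
  rotate r S (axial (ga%:~R * a + de%:~R * b) (al%:~R * a + be%:~R * b)).
Proof.
elim: r => [|n|n].
- exists 0, 1, 1, 0; split=> // a b S; rewrite rotate0.
  by rewrite !mul1r !mul0r addr0 add0r.
- move=> [al [be [ga [de [ab H]]]]].
  exists be, (be - al), de, (de - ga); split.
    by move: ab; rewrite !xpair_eqE; lia.
  move=> a b S /rotate1/H; rewrite -rotateD -addn1 PoszD !rmorphB /=.
  by congr (_ _); congr axial; ring.
- move=> [al [be [ga [de [ab H]]]]].
  exists (al - be), al, (ga - de), ga; split.
    by move: ab; rewrite !xpair_eqE; lia.
  move=> a b S /rotateN1/H; rewrite -rotateD -addn1 PoszD opprD !rmorphB /=.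
  by congr (_ _); congr axial; ring.
Qed.

(** * The U-shape and the grid nodes of its scaled copies *)

Definition ushape : set (plane R) :=
  [set p | exists a b, [/\ 0 <= a <= 1, 0 <= b <= 1,
     [|| b == 0, a == 0 | a == 1] & p = axial a b]].

Lemma edge_axial u d :
  @realization R (Edge u d) = [set p | exists2 s : R, 0 <= s <= 1 &
    p = axial (u.1%:~R + s * (dir d).1%:~R) (u.2%:~R + s * (dir d).2%:~R)].
Proof.
apply/seteqP; split=> p /=.
  move=> [w [w0 w1 ->]]; exists (w 1%N).
    move: w1; rewrite !big_nat_recl // big_geq //= => w1.
    by have := (w0 0%N, w0 1%N); case; lra.
  move: w1; rewrite !big_nat_recl // !big_geq //= => w1.
  rewrite !embedE !axialZ addr0 axialD !rmorphD /=.
  by congr axial; rewrite -[in RHS](mul1r (_%:~R)) -w1; ring.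
move=> [s s01 ->]; exists (fun i => if i is 0%N then 1 - s else s); split.
- by case=> [|i]; lra.
- by rewrite !big_nat_recl // !big_geq //=; lra.
- rewrite !big_nat_recl // !big_geq //= !embedE !axialZ addr0 axialD !rmorphD /=.
  by congr axial; ring.
Qed.

Lemma edge_connected u d : connected (@realization R (Edge u d)).
Proof.
pose f (s : R) : plane R :=
  axial (u.1%:~R + s * (dir d).1%:~R) (u.2%:~R + s * (dir d).2%:~R).
have -> : realization (Edge u d) = f @` `[0, 1].
  rewrite edge_axial; apply/seteqP; split=> p /= [s s01 e]; exists s => //;
  by rewrite ?in_itv //= in s01 *.
apply: connected_continuous_connected; first exact: segment_connected.
apply: continuous_subspaceT => s.
apply: (@cvg_pair _ _ _ _ (nbhs _) (nbhs _)) => /=.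
  by apply: cvgD; [apply: cvgD; [exact: cvg_cst|apply: cvgMl; exact: cvg_id]|
    apply: cvgMl; apply: cvgD; [exact: cvg_cst|apply: cvgMl; exact: cvg_id]].
by apply: cvgMr; apply: cvgD; [exact: cvg_cst|apply: cvgMl; exact: cvg_id].
Qed.

Lemma ushape_cells : ushape =
  \big[setU/set0]_(x <- [:: Edge (0, 0) 1; Edge (0, 0) 0; Edge (1, 0) 1])
    @realization R x.
Proof.
rewrite !big_cons big_nil setU0 !edge_axial; apply/seteqP; split=> p /=.
  move=> [a [b [a01 b01 /or3P[] /eqP e ->]]].
  - by right; left; exists a => //; congr axial => /=; rewrite ?e; ring.
  - by left; exists b => //; congr axial => /=; rewrite ?e; ring.
  - by right; right; exists b => //; congr axial => /=; rewrite ?e; ring.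
case=> [|[|]] [s s01 ->].
- exists 0, s; split => //; rewrite ?eqxx ?orbT //; first by lra.
  by congr axial => /=; ring.
- exists s, 0; split => //; rewrite ?eqxx ?orbT //; first by lra.
  by congr axial => /=; ring.
- exists 1, s; split => //; rewrite ?eqxx ?orbT //; first by lra.
  by congr axial => /=; ring.
Qed.

Lemma ushape_is_shape : is_shape ushape.
Proof.
split; first by eexists; exact: ushape_cells.
  rewrite ushape_cells !big_cons big_nil setU0.
  have nodeE (u : grid) d : realization (Edge u d) (embed R u).
    by rewrite edge_axial; exists 0; [lra|rewrite embedE !mul0r !addr0].
  apply: connectedU; [|exact: edge_connected|].
    exists (embed R (0, 0)); split; [exact: nodeE|left; exact: nodeE].
  apply: connectedU; [|exact: edge_connected..].
  exists (embed R (1, 0)); split; last exact: nodeE.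
  rewrite edge_axial; exists 1; first by lra.
  by rewrite embedE; congr axial => /=; ring.
by exists 0, 0; split; rewrite ?eqxx //; [lra|lra|congr pair => /=; ring].
Qed.

(** [o1] and [o2] are the coordinates of the node chosen as origin: an integer in the unit interval
    is 0 or 1. *)
Lemma embed_translate_ushape (t : grid) :
  translate (embed R t) ushape 0 -> exists o1 o2 : bool, t = (- o1%:Z, - o2%:Z).
Proof.
case=> _ [a [b [a01 b01 ab ->]]]; rewrite embedE axialD.
have <- : axial 0 0 = 0 by rewrite /axial mul0r mulr0 addr0.
move=> /axial_inj[e1 e2].
have int01 (x : int) (c : R) :
    0 <= c <= 1 -> c + x%:~R = 0 -> exists o : bool, x = - o%:Z.
  move=> c01 e; have x1 : (-1 <= x <= 0).
    by rewrite -!(ler_int R) mulrN1z mulr0z; lra.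
  have [x0|x0] : x = 0 \/ x = -1 by lia.
    by exists false.
  by exists true.
have [ox t1] := int01 _ _ a01 e1; have [oy t2] := int01 _ _ b01 e2.
by exists ox, oy; rewrite -t1 -t2; case: t {e1 e2 t1 t2}.
Qed.

Lemma scaled_coord (k : nat) (z : int) (a : R) : 0 <= a <= 1 ->
  z%:~R = k%:R * a -> exists x : nat,
  [/\ z = x%:Z, (x <= k)%N, a == 0 -> x = 0%N & a == 1 -> x = k].
Proof.
move=> /andP[a0 a1] e; have k0 := ler0n R k.
have z0 : 0 <= z by rewrite -(ler0z R) e mulr_ge0.
case: z z0 e => // x _ e; exists x; rewrite -pmulrn in e.
have xk : (x <= k)%N by rewrite -(ler_nat R) e ler_piMr.
split=> // /eqP a_; move: e; rewrite a_ ?mulr0 ?mulr1 => /eqP.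
  by rewrite pnatr_eq0 => /eqP.
by rewrite eqr_nat => /eqP.
Qed.

(** Turns the real geometry into integer arithmetic: the parameters of a grid node of the copy are
    [x / k] and [y / k]. *)
Lemma nodes_ushape (k : nat) (t p u : grid) : (0 < k)%N ->
  nodes (translate (embed R p) (scale k (translate (embed R t) ushape))) u <->
  exists x y : nat, [/\ (x <= k)%N, (y <= k)%N, [|| y == 0%N, x == 0%N | x == k] &
    u = (p.1 + k%:Z * t.1 + x%:Z, p.2 + k%:Z * t.2 + y%:Z)].
Proof.
move=> k0; have kR : k%:R != 0 :> R by rewrite pnatr_eq0 -lt0n.
have kZ : k%:Z%:~R = k%:R :> R by rewrite pmulrn.
split.
  case=> _ [_ [_ [a [b [a01 b01 ab ->]]] <-] <-].
  rewrite !embedE /= axialD axialZ axialD => /axial_inj[e1 e2].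
  have [|x [ex xk x0 x1]] := @scaled_coord k (u.1 - p.1 - k%:Z * t.1) a a01.
    by rewrite !rmorphB rmorphM /= kZ -e1; ring.
  have [|y [ey yk y0 y1]] := @scaled_coord k (u.2 - p.2 - k%:Z * t.2) b b01.
    by rewrite !rmorphB rmorphM /= kZ -e2; ring.
  exists x, y; split=> //; last first.
    by rewrite -ex -ey; case: (u) => ? ?; congr pair => /=; ring.
  case/or3P: ab => [/y0->|/x0->|/x1->]; rewrite eqxx ?orbT //.
move=> [x [y [xk yk xy ->]]].
have quot (n : nat) : (n <= k)%N -> 0 <= n%:R / k%:R <= (1 : R).
  move=> nk; rewrite divr_ge0 // ler_pdivrMr ?ltr0n // mul1r ler_nat nk //.
pose a : R := x%:R / k%:R; pose b : R := y%:R / k%:R.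
exists (k%:R *: (axial a b + embed R t)).
  exists (axial a b + embed R t) => //; exists (axial a b) => //.
  exists a, b; split=> //; try exact: quot.
  by case/or3P: xy => /eqP e; rewrite /a /b e ?mul0r ?divff ?eqxx ?orbT.
rewrite !embedE axialD axialZ axialD /= !rmorphD !rmorphM /= !kZ -!pmulrn.
by congr axial; rewrite /a /b; field.
Qed.

(** * The maximal scale *)

Lemma kmax_eq (k : nat) (A : {fset grid}) (S : set (plane R)) r :
  placements (scale k (rotate r S)) A !=set0 ->
  (forall k' r', placements (scale k' (rotate r' S)) A !=set0 -> (k' <= k)%N) ->
  kmax S A = (k%:R)%:E.
Proof.
move=> kS ub; apply/eqP; rewrite eq_le; apply/andP; split.
  by apply: ge_ereal_sup => _ [k' [r' k'S] <-];
    rewrite lee_fin ler_nat; exact: ub k'S.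
by apply: ereal_sup_ubound; exists k => //; exists r.
Qed.

(* No rotation makes both unit edges at the corner (0, 0) horizontal. *)
Lemma placement_height (k h : nat) (r : int) (t : grid) (A : {fset grid}) :
  (forall u, u \in A -> 0 <= u.2 <= h%:Z) ->
  placements (scale k (rotate r (translate (embed R t) ushape))) A !=set0 ->
  (k <= h)%N.
Proof.
move=> Ah [p [_ pA]].
have [al [be [ga [de [ab H]]]]] := rotate_axial r.
have inA (x y : int) : ushape (axial x%:~R y%:~R) ->
    0 <= p.2 + k%:Z * (al * (x + t.1) + be * (y + t.2)) <= h%:Z.
  move=> Uxy; pose v := (p.1 + k%:Z * (ga * (x + t.1) + de * (y + t.2)),
                         p.2 + k%:Z * (al * (x + t.1) + be * (y + t.2))).
  apply: (Ah v); apply: pA.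
  exists (k%:R *: axial (ga%:~R * (x + t.1)%:~R + de%:~R * (y + t.2)%:~R)
                        (al%:~R * (x + t.1)%:~R + be%:~R * (y + t.2)%:~R)).
    eexists; last reflexivity; apply: H; exists (axial x%:~R y%:~R) => //.
    by rewrite embedE axialD !rmorphD.
  rewrite !embedE axialZ axialD /v /=.
  by congr axial;
    rewrite !rmorphD !rmorphM /= !rmorphD !rmorphM !rmorphD /= -!pmulrn; ring.
have U (x y : bool) : ~~ (x && y) -> ushape (axial x%:R y%:R).
  move=> xy; exists x%:R, y%:R.
  split=> //; rewrite ?ler0n ?ler1n ?lern1 ?leq_b1 //.
  by move: xy; case: x; case: y; rewrite //= !eqxx ?orbT.
have := inA 0 0 (U false false isT).
have := inA 1 0 (U true false isT).
have := inA 0 1 (U false true isT).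
move: ab; rewrite xpair_eqE => ab.
(* The images of the two arm ends differ in height from that of the corner by [k * al] and [k * be].
   One of these is at least [k] in absolute value, while all heights lie between 0 and [h]. *)
have [al1|[al1|[be1|be1]]] :
    1 <= al \/ (al <= -1 \/ (1 <= be \/ be <= -1)) by lia.
all: nia.
Qed.

End UShape.

(** * Placements in the towers *)

Lemma towers_placement (R : realType) (m x : nat) (ox oy : bool)
    (D : pred int) :
  (0 < m)%N -> (x < m)%N ->
  placements (scale (2 * m) (translate (embed R (- ox%:Z, - oy%:Z)) (@ushape R)))
    (towers m D) (x%:Z + (2 * m * ox)%N%:Z, (2 * m * oy)%N%:Z) <->
  ~~ D x%:Z && ~~ D (x + 2 * m)%N%:Z.
Proof.
(* The copy has its lower left corner at [(x, 0)], and its origin is shifted from there by [2 * m]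
   times [(ox, oy)]. Its arms are the columns [x] and [x + 2 * m], where only the tops depend on
   [D]. *)
move=> m0 xm; have k0 : (0 < 2 * m)%N by lia.
split=> [[_ pA]|/andP[nDl nDr]].
  have top (i : nat) : (i = 0)%N \/ i = (2 * m)%N -> ~~ D (x + i)%N%:Z.
    move=> i02; have : ((x + i)%N%:Z, (2 * m)%N%:Z) \in towers m D.
      apply: pA; apply/(nodes_ushape _ _ _ _ k0).
      exists i, (2 * m)%N; split=> //.
      - by lia.
      - by case: i02 => ->; rewrite eqxx ?orbT.
      - by congr pair => /=; case: ox oy => [] []; lia.
    rewrite towersE => /and5P[_ _ _ _ /=]; move: (D _) => d; lia.
  by apply/andP; split; [rewrite -[x]addn0; apply: top; left|apply: top; right].
have shapeA (u : grid) :
    nodes (translate (embed R (x%:Z + (2 * m * ox)%N%:Z, (2 * m * oy)%N%:Z))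
      (scale (2 * m) (translate (embed R (- ox%:Z, - oy%:Z)) (@ushape R)))) u ->
    u \in towers m D.
  move=> /(nodes_ushape _ _ _ _ k0)[a [b [ak bk ab ->]]].
  rewrite towersE /in_towers /=.
  rewrite (_ : _ + _ + a%:Z = (x + a)%N%:Z); last by case: ox; lia.
  rewrite (_ : _ + _ + b%:Z = b%:Z); last by case: oy; lia.
  case/or3P: ab => /eqP e; rewrite e; first by lia.
    by rewrite addn0 nDl; lia.
  by rewrite nDr; lia.
(* The placement point is occupied because it is itself a node of the copy. *)
split=> //; apply: shapeA; apply/(nodes_ushape _ _ _ _ k0).
exists (2 * m * ox)%N, (2 * m * oy)%N; split.
- by case: ox; lia.
- by case: oy; lia.
- by case: ox oy => [] []; rewrite ?muln0 ?muln1 ?eqxx ?orbT.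
- by congr pair => /=; case: ox oy => [] []; lia.
Qed.

(** The copy over column 0 attains scale [2 * m], and the height of the towers excludes larger
    scales in every rotation. *)
Lemma towers_kmax (R : realType) (m : nat) (ox oy : bool) (D : pred int) :
  (0 < m)%N -> ~~ D 0 -> ~~ D (2 * m)%N%:Z ->
  kmax (translate (embed R (- ox%:Z, - oy%:Z)) (@ushape R)) (towers m D) =
  ((2 * m)%:R)%:E.
Proof.
move=> m0 D0 D2; apply: (@kmax_eq _ _ _ _ 0).
  rewrite rotate0; eexists; apply/(@towers_placement R m 0 ox oy D) => //.
  by rewrite D0 add0n.
move=> k r; apply: placement_height => -[a b]; rewrite towersE.
by move=> /and5P[/= _ _ b0 b2 _]; lia.
Qed.

(* The missing tops are in the tower that does not contain the origins of the
   placements.  Column 0 is always complete, so that kmax does not depend on Y. *)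
Definition missing (m n : nat) (o : bool) (Y : {set 'I_n}) : pred int :=
  fun x => [exists i in Y, x == (i.+1 + 2 * m * ~~ o)%N].

Lemma in_missing m n o Y (i : 'I_n) :
  @missing m n o Y (i.+1 + 2 * m * ~~ o)%N%:Z = (i \in Y).
Proof.
apply/existsP/idP => [[j /andP[jY /eqP e]]|iY].
  suff -> : i = j by [].
  by apply: val_inj => /=; lia.
by exists i; rewrite iY eqxx.
Qed.

Lemma missing_half m o Y u : half m o u -> @missing m m.-1 o Y u.1 = false.
Proof.
move=> Lu; apply/existsP => -[i /andP[_ /eqP e]]; move: Lu; rewrite /half e.
by have := ltn_ord i; case: o {e}; lia.
Qed.

Lemma missing_first m o Y (j : bool) :
  @missing m m.-1 o Y (2 * m * j)%N%:Z = false.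
Proof.
apply/existsP => -[i /andP[_ /eqP[]]].
by have := ltn_ord i; case: o j => [] []; lia.
Qed.

(** * The runtime bound and the contradiction *)

Lemma littleo_sqrt (R : realType) (T : nat -> nat) (q : nat) :
  (fun n => (T n)%:R : R^o) =o_\oo (fun n => Num.sqrt n%:R : R^o) ->
  exists N, forall n s, (N <= n)%N -> (n <= s ^ 2)%N -> (q * T n <= s)%N.
Proof.
move=> /eqoP To.
(* The successor keeps epsilon meaningful for [q = 0]. *)
have e0 : 0 < (q.+1%:R)^-1 :> R by rewrite invr_gt0.
have [N _ HN] := To _ e0; exists N => n s Nn ns.
have := HN n Nn; rewrite /= normr_nat ger0_norm // => h.
have qT : q.+1%:R * (T n)%:R <= Num.sqrt n%:R :> R.
  by rewrite -ler_pdivlMl.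
have ss : Num.sqrt n%:R <= s%:R :> R.
  by rewrite -[leRHS]ger0_norm // -sqrtr_sqr ler_wsqrtr // -natrX ler_nat.
have : (q.+1 * T n <= s)%N by rewrite -(ler_nat R) natrM (le_trans qT).
by apply: leq_trans; rewrite leq_mul2r leqnSn orbT.
Qed.

Theorem theorem3p1 (R : realType) :
  exists2 S0 : set (plane R), is_shape S0 &
  forall t : grid,
  let S := translate (embed R t) S0 in
  S 0 ->
  forall (alg : algorithm) (T : nat -> nat),
  (fun n => (T n)%:R : R^o) =o_\oo (fun n => Num.sqrt n%:R : R^o) ->
  (forall (A : {fset grid}) (k : nat),
     amoebot_structure A -> kmax S A = (k%:R)%:E ->
     terminates_within alg k A (T #|` A|)) ->
  exists (A : {fset grid}) (k : nat),
    [/\ amoebot_structure A,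
        kmax S A = (k%:R)%:E &
        ~ computes alg k A (placements (scale k S) A)].
Proof.
exists (@ushape R); first exact: ushape_is_shape.
move=> t /= /embed_translate_ushape[ox [oy ->]] alg T To term.
set S := translate _ _ in term *.
(* If no structure fails, the algorithm is correct on the whole family below at the common scale
   [2 * m], so the counting bound applies. *)
apply: contrapT => nofail.
(* The size is at most [(3 * m) ^ 2], so [q * T <= 3 * m]; the factor 3 cancels and leaves
   [T <= m %/ (12 * links alg).+1]. *)
pose q := (3 * (12 * links alg).+1)%N.
have [N TN] := littleo_sqrt q To.
have [m m3 Nm] : exists2 m, (3 <= m)%N & (N <= m)%N by exists N.+3; lia.
have m0 : (0 < m)%N by lia.
pose A (Y : {set 'I_m.-1}) := towers m (missing m ox Y).
have strA Y : amoebot_structure (A Y) by apply: towers_structure.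
have kmaxA Y : kmax S (A Y) = (2 * m)%:R%:E.
  apply: towers_kmax => //; apply/negbT.
    by have := missing_first ox Y false; rewrite muln0.
  by have := missing_first ox Y true; rewrite muln1.
have := @bottleneck_count alg (2 * m) m.-1 (m %/ (12 * links alg).+1)
  (half m ox) (gate m ox) A (fun Y => placements (scale (2 * m) S) (A Y))
  (fun i => (i.+1%:Z + (2 * m * ox)%N%:Z, (2 * m * oy)%N%:Z)).
have Lp (i : 'I_m.-1) :
    half m ox (i.+1%:Z + (2 * m * ox)%N%:Z, (2 * m * oy)%N%:Z).
  by rewrite /half /=; have := ltn_ord i; case: (ox); lia.
move=> count; have : (m.-1 <= 6 * links alg * (m %/ (12 * links alg).+1))%N.
  apply: count => //.
  - by move=> Y; rewrite towersE /in_towers /gate; case: (ox) => /=; lia.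
  - by move=> Y; apply: towers_bottleneck.
  - by move=> Y Y'; apply: towers_agree => // u Lu; rewrite !missing_half.
  - move=> Y; exists (T #|` A Y|); last exact: term.
    rewrite leq_divRL // mulnC.
    have := TN #|` A Y| (3 * m)%N; rewrite /q -mulnA leq_pmul2l //; apply.
      by apply: leq_trans (card_towers_lb _ _).
    exact: card_towers_ub.
  - move=> Y; apply: contrapT => nY; apply: nofail.
    by exists (A Y), (2 * m)%N.
  - move=> Y i; rewrite towersE /in_towers missing_half ?Lp //.
    by rewrite /=; have := ltn_ord i; case: (ox) (oy) => -[]; lia.
  - move=> Y i; have im := ltn_ord i.
    apply: (iff_trans (@towers_placement R m i.+1 ox oy _ m0 _)); first by lia.
    (* Of the two tops that decide a placement, the one on the side of the origins is always
       present, so validity reveals exactly whether [i] is in [Y]. *)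
    have vis (x : int) : half m ox (x, 0) -> missing m ox Y x = false.
      exact: (@missing_half m ox Y (x, 0)).
    have := in_missing m ox Y i; case: (ox) vis => vis.
      rewrite muln0 addn0 => ->; rewrite vis ?andbT //.
      by rewrite /half /=; lia.
    rewrite muln1 => ->; rewrite vis // /half /=; lia.
(* The count now gives [m - 1 < m / 2], which is impossible for [3 <= m]. *)
have := leq_divM m (12 * links alg).+1; nia.
Qed.
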